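(* Let $G=((X,Y),E)$ be a split graph with $\sigma(G)=2$ and even maximum degree $\Delta(G)$. Let $P$ be the set of pendant vertices of $G$. Then the following are equivalent: 1. $G$ is neighborhood-overfull. 2. There exists $v\in X$ such that $v$ is universal in $G[V\setminus P]$, $\Delta(G[N[v]])=\Delta(G)$, and $G[N[v]]$ is overfull.
   Context: All graphs are simple, finite, connected and undirected. A split graph $G=((X,Y),E)$ is a graph whose vertex set is partitioned into a clique $X$ and an independent set $Y$; $X$ is taken to be a maximal clique. A tree $t$-spanner of a connected graph $G$ is a spanning tree $T$ of $G$ with $d_T(u,w)\le t$ for every edge $uw$ of $G$. The stretch index $\sigma(G)$ is the least $t$ for which $G$ admits a tree $t$-spanner. Pendant vertices are the vertices of degree $1$. $N[v]=N(v)\cup\{v\}$ is the closed neighborhood of $v$, and $G[S]$ is the subgraph induced by $S$. A vertex is universal in a graph if it is adjacent to all other vertices of that graph. A graph $H$ is overfull if $|E(H)|>\Delta(H)\cdot\lfloor |V(H)|/2\rfloor$. $G$ is neighborhood-overfull if there is a vertex $v$ with $d_G(v)=\Delta(G)$ such that $G[N[v]]$ is overfull. In that case $\Delta(G[N[v]])=\Delta(G)$. *)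

(* Defs.v *)
From HB Require Import structures.
From mathcomp Require Import all_boot.

Set Implicit Arguments.
Unset Strict Implicit.
Unset Printing Implicit Defensive.

Record sgraph (V : finType) := SGraph {
  adj :> rel V;
  adj_sym : symmetric adj;
  adj_irr : irreflexive adj
}.

Section Induced.
Variables (V : finType) (G : sgraph V) (S : {set V}).

Definition induced_adj : rel {x : V | x \in S} := fun x y => G (val x) (val y).

Lemma induced_sym : symmetric induced_adj.
Proof. by move=> x y; exact: adj_sym. Qed.

Lemma induced_irr : irreflexive induced_adj.
Proof. by move=> x; exact: adj_irr. Qed.

Definition induced : sgraph {x : V | x \in S} := SGraph induced_sym induced_irr.
End Induced.

Section Basics.
Variables (V : finType) (G : sgraph V).
Implicit Types (v x y : V) (A X Y : {set V}).

Definition neigh v : {set V} := [set u | G v u].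
Definition closed_neigh v : {set V} := v |: neigh v.
Definition deg v : nat := #|neigh v|.
Definition max_deg : nat := \max_(v : V) deg v.
Definition pendants : {set V} := [set v | deg v == 1].
Definition edges : {set {set V}} :=
  [set [set p.1; p.2] | p : V * V & G p.1 p.2].

Definition overfull : bool := max_deg * #|V|./2 < #|edges|.

Definition universal v : bool := [forall u, (u != v) ==> G v u].

Definition connected : bool := (0 < #|V|) && [forall x, forall y, connect G x y].

(* A shortest path has fewer than #|V| edges, so this is the usual distance
   when y is reachable from x; otherwise it takes the junk value #|V|. *)
Definition dist x y : nat :=
  find (fun n => [exists p : n.-tuple V, path G x p && (last x p == y)])
       (iota 0 #|V|).

(* The size condition discards the closed walks of length 2 along an edge,
   which ucycle accepts. *)
Definition acyclic : Prop := forall c : seq V, 2 < size c -> ~~ ucycleb G c.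

Definition is_tree : Prop := connected /\ acyclic.

Definition clique A : bool :=
  [forall x in A, forall y in A, (x != y) ==> G x y].
Definition independent A : bool :=
  [forall x in A, forall y in A, ~~ G x y].

(* Y may be empty: complete graphs are split graphs. *)
Definition split_partition X Y : Prop :=
  [/\ X :|: Y = [set: V], [disjoint X & Y], maxset clique X & independent Y].

End Basics.

Definition universal_in (V : finType) (G : sgraph V) (S : {set V}) (v : V) : bool :=
  [exists u : {x : V | x \in S}, (val u == v) && universal (induced G S) u].

Definition spanning_tree (V : finType) (G T : sgraph V) : Prop :=
  is_tree T /\ subrel T G.

Definition tree_spanner (V : finType) (G : sgraph V) (t : nat) (T : sgraph V) : Prop :=
  spanning_tree G T /\ forall u w : V, G u w -> dist T u w <= t.

Definition has_tree_spanner (V : finType) (G : sgraph V) (t : nat) : Prop :=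
  exists T : sgraph V, tree_spanner G t T.

Definition stretch_index_is (V : finType) (G : sgraph V) (t : nat) : Prop :=
  has_tree_spanner G t /\ forall s : nat, has_tree_spanner G s -> t <= s.

Definition neighborhood_overfull (V : finType) (G : sgraph V) : Prop :=
  exists v : V, deg G v = max_deg G /\ overfull (induced G (closed_neigh G v)).

(* Main.v *)
(** Let [T] be a tree 2-spanner and suppose [|X| >= 3].  Since [T] has no short
    cycles, the vertices of the clique [X] all lie in one closed [T]-neighborhood
    [N_T[c]], with [c] in [X] by maximality; then every non-pendant vertex of [Y]
    is adjacent to [c].
    Now let [v] have maximum degree, with [G[N[v]]] overfull.  If [v] missed a
    non-pendant vertex [w], then [c] would be adjacent to [w], and as
    [deg c <= deg v] it would miss some neighbor [p] of [v], which must be pendant.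
    A graph on [D + 1] vertices ([D] even) with maximum degree [D] and a pendant
    vertex has at most [(D * D + 1) / 2] edges, hence is not overfull. *)
Require Import Defs.
From mathcomp Require Import all_boot zify.

Set Implicit Arguments.
Unset Strict Implicit.
Unset Printing Implicit Defensive.

(** * Edge counting and overfullness *)

Section Degrees.
Variables (V : finType) (G : sgraph V).

Lemma deg_le_max v : deg G v <= max_deg G.
Proof. exact: (leq_bigmax (F := deg G)). Qed.

Lemma card_closed_neigh v : #|closed_neigh G v| = (deg G v).+1.
Proof. by rewrite cardsU1 inE adj_irr. Qed.

(** Double counting: an edge has at least two preimages, [(a, b)] and [(b, a)], among the ordered
    adjacent pairs. *)
Lemma handshake_leq : 2 * #|edges G| <= \sum_(v : V) deg G v.
Proof.
pose D := [set p : V * V | G p.1 p.2].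
have -> : \sum_(v : V) deg G v = \sum_(p in D) 1.
  transitivity (\sum_(v : V) \sum_(u | G v u) 1).
    by apply: eq_bigr => v _; rewrite sum1_card; apply: eq_card => u; rewrite !inE.
  by rewrite pair_big_dep /=; apply: eq_bigl => -[a b]; rewrite inE.
pose f (p : V * V) := [set p.1; p.2].
have -> : edges G = f @: D.
  by apply/setP => e; apply/imsetP/imsetP => -[p Hp ->]; exists p => //;
    rewrite !inE in Hp *.
rewrite (partition_big_imset f) /= mulnC -sum_nat_const.
apply: leq_sum => e /imsetP[[a b]]; rewrite inE /= => Gab ->.
have ab : a != b by apply: contraTneq Gab => ->; rewrite adj_irr.
rewrite sum1_card.
have <- : #|[set (a, b); (b, a)]| = 2.
  by rewrite cards2 xpair_eqE (negbTE ab).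
apply/subset_leq_card/subsetP => q; rewrite !inE => /orP[]/eqP->;
  rewrite unfold_in /= inE /=.
  by rewrite Gab eqxx.
by rewrite adj_sym Gab /f /= setUC eqxx.
Qed.

(** With [D] the maximum degree, the degree sum is at most [D * D + 1]. As [D] is even, this leaves
    at most [D * (D / 2)] edges, exactly the overfullness threshold for [D + 1] vertices. *)
Lemma not_overfull_deg_le1 p :
  ~~ odd (max_deg G) -> #|V| = (max_deg G).+1 -> deg G p <= 1 -> ~~ overfull G.
Proof.
move=> evD cardV degp; rewrite /overfull cardV -leqNgt.
have := handshake_leq; rewrite (bigD1 p) //=.
have : \sum_(v | v != p) deg G v <= \sum_(v | v != p) max_deg G.
  by apply: leq_sum => v _; exact: deg_le_max.
rewrite sum_nat_const cardC1 cardV /=.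
rewrite uphalf_half (negbTE evD) add0n.
have := odd_double_half (max_deg G); rewrite (negbTE evD) add0n.
move: (max_deg G) (_./2) => D h <-; nia.
Qed.

Lemma connected_deg_gt0 x y : connected G -> x != y -> 0 < deg G x.
Proof.
case/andP=> _ /forallP/(_ x)/forallP/(_ y)/connectP[[|z s] /=].
  by move=> _ ->; rewrite eqxx.
by case/andP=> Gxz _ _ _; apply/card_gt0P; exists z; rewrite inE.
Qed.

End Degrees.

(** * Degrees in induced subgraphs *)

Section InducedDegrees.
Variables (V : finType) (G : sgraph V) (S : {set V}).

Lemma deg_induced (x : {x : V | x \in S}) :
  deg (induced G S) x = #|neigh G (val x) :&: S|.
Proof.
rewrite /deg -(card_imset _ val_inj); apply: eq_card => u; rewrite !inE.
apply/imsetP/andP => [[z]|[Gxu uS]]; last by exists (Sub u uS); rewrite ?inE.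
by rewrite inE => Gxz ->; split=> //; exact: valP.
Qed.

Lemma deg_induced_le (x : {x : V | x \in S}) :
  deg (induced G S) x <= deg G (val x).
Proof. by rewrite deg_induced subset_leq_card // subsetIl. Qed.

Lemma max_deg_induced_le : max_deg (induced G S) <= max_deg G.
Proof.
apply/bigmax_leqP => x _.
exact: leq_trans (deg_induced_le x) (deg_le_max _ _).
Qed.

End InducedDegrees.

(** Forward: a vertex of maximum degree in the induced graph has its neighbors in [N[v]] minus
    itself, a set of size [deg G v]. Backward: [v] keeps all its neighbors. *)
Lemma max_deg_induced_closed_neigh (V : finType) (G : sgraph V) v :
  max_deg (induced G (closed_neigh G v)) = max_deg G <-> deg G v = max_deg G.
Proof.
have vS : v \in closed_neigh G v by rewrite !inE eqxx.
split=> [eqD | degv]; apply/eqP; rewrite eqn_leq ?deg_le_max ?max_deg_induced_le /=.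
  have Vgt0 : 0 < #|{: {x | x \in closed_neigh G v}}|.
    by apply/card_gt0P; exists (Sub v vS).
  have [x Ex] := eq_bigmax (deg (induced G (closed_neigh G v))) Vgt0.
  rewrite -eqD /max_deg Ex deg_induced -ltnS -(card_closed_neigh G v) -add1n.
  rewrite (cardsD1 (val x) (closed_neigh G v)) (valP x) leq_add2l.
  apply/subset_leq_card/subsetP => u; rewrite in_setI !in_setD1 inE => /andP[Gxu ->].
  by rewrite andbT; apply: contraTneq Gxu => ->; rewrite adj_irr.
rewrite -degv; apply: leq_trans (deg_le_max _ (Sub v vS)).
rewrite deg_induced; apply/subset_leq_card/subsetP => u.
by rewrite !inE /= => ->; rewrite orbT.
Qed.

(** * Distances, short cycles and centers in trees *)

Section TreeSpanner.
Variables (V : finType) (T : sgraph V).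

(* The size hypothesis rules out the junk value [#|V|] of [dist]. *)
Lemma dist_le2 x y :
  2 < #|V| -> x != y -> dist T x y <= 2 -> T x y \/ exists2 z, T x z & T z y.
Proof.
move=> V2 nxy dxy; have dV : dist T x y < #|V| by exact: leq_ltn_trans V2.
pose P n := [exists p : n.-tuple V, path T x p && (last x p == y)].
have hasP : has P (iota 0 #|V|) by rewrite has_find size_iota.
have := nth_find 0 hasP; rewrite -/(dist T x y) nth_iota // add0n.
case/existsP=> -[p /= /eqP sz] /andP[pth /eqP lst].
move: dxy; rewrite -sz; case: p pth lst {sz} => [|a [|b [|? ?]]] //=.
- by move=> _ exy; rewrite exy eqxx in nxy.
- by rewrite andbT => Txa <-; left.
- by rewrite andbT => /andP[Txa Tab] <- _; right; exists a.
Qed.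

Hypothesis acT : acyclic T.

Lemma adj_neq x y : T x y -> x != y.
Proof. by apply: contraTneq => ->; rewrite adj_irr. Qed.

Lemma no_cycle3 a b c : T a b -> T b c -> T c a -> False.
Proof.
move=> ab bc ca; have /negP := acT (c := [:: a; b; c]) erefl; apply.
rewrite /ucycleb /= ab bc ca !inE negb_or (adj_neq ab) (adj_neq bc).
by rewrite eq_sym (adj_neq ca).
Qed.

Lemma no_cycle4 a b c d :
  a != c -> b != d -> T a b -> T b c -> T c d -> T d a -> False.
Proof.
move=> ac bd Tab Tbc Tcd Tda; have /negP := acT (c := [:: a; b; c; d]) erefl.
apply; rewrite /ucycleb /= Tab Tbc Tcd Tda !inE !negb_or ac bd.
by rewrite (adj_neq Tab) (adj_neq Tbc) (adj_neq Tcd) eq_sym (adj_neq Tda).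
Qed.

(* The five chords need no hypotheses: a coincidence of two vertices at
   distance 2 leaves a triangle. *)
Lemma no_cycle5 a b c d e :
  T a b -> T b c -> T c d -> T d e -> T e a -> False.
Proof.
move=> Tab Tbc Tcd Tde Tea.
have ac : a != c by apply/eqP => E; subst c; exact: (no_cycle3 Tcd Tde Tea).
have ad : a != d by apply/eqP => E; subst d; exact: (no_cycle3 Tab Tbc Tcd).
have bd : b != d by apply/eqP => E; subst d; exact: (no_cycle3 Tab Tde Tea).
have be : b != e by apply/eqP => E; subst e; exact: (no_cycle3 Tbc Tcd Tde).
have ce : c != e by apply/eqP => E; subst e; exact: (no_cycle3 Tab Tbc Tea).
have /negP := acT (c := [:: a; b; c; d; e]) erefl; apply.
rewrite /ucycleb /= Tab Tbc Tcd Tde Tea !inE !negb_or ac ad bd be ce.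
rewrite (adj_neq Tab) (adj_neq Tbc) (adj_neq Tcd) (adj_neq Tde).
by rewrite eq_sym (adj_neq Tea).
Qed.

Lemma no_cycle6 a b c d e f :
  a != c -> a != d -> a != e -> b != d -> b != e -> b != f -> c != e ->
  c != f -> d != f ->
  T a b -> T b c -> T c d -> T d e -> T e f -> T f a -> False.
Proof.
move=> ac ad ae bd be bf ce cf df Tab Tbc Tcd Tde Tef Tfa.
have /negP := acT (c := [:: a; b; c; d; e; f]) erefl; apply.
rewrite /ucycleb /= Tab Tbc Tcd Tde Tef Tfa !inE !negb_or.
rewrite ac ad ae bd be bf ce cf df (adj_neq Tab) (adj_neq Tbc) (adj_neq Tcd).
by rewrite (adj_neq Tde) (adj_neq Tef) eq_sym (adj_neq Tfa).
Qed.

(* The Helly property of the unit balls of a tree. *)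
Lemma center_of_diameter_le2 (X : {set V}) a0 b0 :
    a0 \in X -> b0 \in X -> a0 != b0 ->
    {in X &, forall x y, x != y -> T x y \/ exists2 z, T x z & T z y} ->
  exists c, forall x, x \in X -> x != c -> T c x.
Proof.
move=> a0X b0X nab near.
case: (boolP [exists a in X, exists b in X, T a b]).
  case/exists_inP=> a aX /exists_inP[b bX Tab].
  (* One end of the tree edge [ab] will be the center. A [z] adjacent to neither end would close the
     cycle [z p a b q]. *)
  have ab_adj z : z \in X -> z != a -> z != b -> T z a \/ T z b.
    move=> zX za zb.
    case: (near _ _ zX aX za) => [|[p Tzp Tpa]]; first by left.
    case: (near _ _ zX bX zb) => [|[q Tzq Tqb]]; first by right.
    exfalso; apply: (no_cycle5 Tzp Tpa Tab (d := b) (e := q)).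
      by rewrite adj_sym.
    by rewrite adj_sym.
  case: (boolP [forall z in X, (z != a) ==> T a z]) => [/forall_inP all_a|].
    by exists a => x xX xa; exact: implyP (all_a x xX) xa.
  case/forall_inPn=> z zX; rewrite negb_imply => /andP[za nTaz].
  have zb : z != b by apply: contraNneq nTaz => ->.
  have Tbz : T b z.
    by case: (ab_adj z zX za zb); rewrite adj_sym // (negbTE nTaz).
  (* Since [a] misses [z], the center is [b]: an [x] attached to [a] gives the path [x a b z], which
     [near] closes to a cycle of length 4 or 5. *)
  exists b => x xX xb; have [->|xa] := eqVneq x a; first by rewrite adj_sym.
  case: (ab_adj x xX xa xb); last by rewrite adj_sym.
  move=> Txa; have xz : x != z.
    by apply: contraNneq nTaz => <-; rewrite adj_sym.
  case: (near _ _ xX zX xz) => [Txz|[m Txm Tmz]]; exfalso.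
    apply: (no_cycle4 xb _ Txa Tab Tbz); last by rewrite adj_sym.
    by rewrite eq_sym.
  by apply: (no_cycle5 Txa Tab Tbz (d := z) (e := m)); rewrite adj_sym.
move=> noT.
have noTX x y : x \in X -> y \in X -> T x y = false.
  move=> xX yX; apply/negP => Txy; case/negP: noT.
  by apply/exists_inP; exists x => //; apply/exists_inP; exists y.
have mid x y : x \in X -> y \in X -> x != y ->
    exists2 z, z \notin X & T x z /\ T z y.
  move=> xX yX xy; case: (near _ _ xX yX xy); first by rewrite noTX.
  case=> z Txz Tzy; exists z => //.
  by apply/negP => zX; rewrite noTX in Txz.
have neqX x y : x \in X -> y \notin X -> x != y by move=> xX; apply: contraNneq => <-.
(* The midpoint [c] of [a0] and [b0] is the center. If it missed [z], the midpoints [p] and [q]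
   would give a 4-cycle when equal and a hexagon otherwise. The hexagon alternates between [X] and
   its complement, so opposite vertices differ. *)
have [c cX [Tac Tcb]] := mid _ _ a0X b0X nab.
exists c => z zX _; apply/idPn => nTcz.
have za : z != a0 by apply: contraNneq nTcz => ->; rewrite adj_sym.
have zb : z != b0 by apply: contraNneq nTcz => ->.
have [p pX [Tzp Tpa]] := mid _ _ zX a0X za.
have [q qX [Tzq Tqb]] := mid _ _ zX b0X zb.
have pc : p != c by apply: contraNneq nTcz => <-; rewrite adj_sym.
have qc : q != c by apply: contraNneq nTcz => <-; rewrite adj_sym.
have [pq|pq] := eqVneq p q.
  subst q; apply: (no_cycle4 nab _ Tac Tcb (d := p)) => //.
    by rewrite eq_sym.
  by rewrite adj_sym.
apply: (@no_cycle6 z p a0 c b0 q) => //.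
- exact: neqX.
- by rewrite eq_sym neqX.
- exact: neqX.
- by rewrite eq_sym.
- by rewrite adj_sym.
- by rewrite adj_sym.
Qed.

End TreeSpanner.

(** * Split graphs and their tree 2-spanners *)

Section SplitGraph.
Variables (V : finType) (G : sgraph V) (X Y : {set V}).
Hypothesis splitG : split_partition G X Y.

Lemma split_clique x y : x \in X -> y \in X -> x != y -> G x y.
Proof.
case: splitG => _ _ /maxsetp cl _ xX yX.
by move/forall_inP: cl => /(_ x xX)/forall_inP/(_ y yX)/implyP.
Qed.

Lemma split_notinX x : x \notin X -> x \in Y.
Proof.
by case: splitG => /setP/(_ x) + _ _ _; rewrite !inE => + /negbTE xX; rewrite xX.
Qed.

Lemma split_adjX x y : x \notin X -> G x y -> y \in X.
Proof.
move=> /split_notinX xY Gxy; apply/idPn => /split_notinX yY.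
case: splitG => _ _ _ /forall_inP/(_ x xY)/forall_inP/(_ y yY).
by rewrite Gxy.
Qed.

(** Otherwise [v |: X] would be a clique, against the maximality of [X]. *)
Lemma split_nonadj v : v \notin X -> exists2 x, x \in X & ~~ G v x.
Proof.
move=> vX; case: (boolP [exists x in X, ~~ G v x]) => [/exists_inP //|].
rewrite negb_exists_in => /forall_inP allv.
have {allv} allv x : x \in X -> G v x by move=> /allv; rewrite negbK.
case: splitG => _ _ /maxsetP[_ maxX] _.
suff E : v |: X = X by rewrite -E setU11 in vX.
apply: maxX; last exact: subsetUr.
apply/forall_inP => x /setU1P[->|xX]; apply/forall_inP => y /setU1P[->|yX];
  apply/implyP => xy.
- by rewrite eqxx in xy.
- exact: allv.
- by rewrite adj_sym allv.
- exact: split_clique.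
Qed.

(** A vertex [v] outside [X] has all its neighbors in [X] and misses one element, so its degree is
    below [#|X|]. A neighbor [u] of [v] has larger degree, because [N[u]] contains [v |: X]. *)
Lemma max_deg_in_clique v : connected G -> deg G v = max_deg G -> v \in X.
Proof.
move=> conG degv; apply/idPn => vX; have [x xX nGvx] := split_nonadj vX.
have vx : v != x by apply: contraNneq vX => ->.
have /card_gt0P[u] := connected_deg_gt0 conG vx; rewrite inE => Gvu.
have uX := split_adjX vX Gvu.
have := deg_le_max G u; rewrite -degv leqNgt => /negP; apply.
rewrite -ltnS -(card_closed_neigh G u).
have lt1 : deg G v < #|X|.
  rewrite (cardsD1 x X) xX add1n ltnS; apply/subset_leq_card/subsetP => y.
  rewrite !inE => Gvy; rewrite (split_adjX vX Gvy) andbT.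
  by apply: contraNneq nGvx => <-.
apply: (@leq_trans #|v |: X|); first by rewrite cardsU1 vX add1n.
apply/subset_leq_card/subsetP => y /setU1P[->|yX]; rewrite !inE.
  by rewrite adj_sym Gvu orbT.
by have [//|yu] := eqVneq y u; rewrite split_clique // eq_sym.
Qed.

Lemma split_spanner_center :
    has_tree_spanner G 2 -> 2 < #|X| ->
  exists2 c, c \in X & forall w, w \notin X -> 1 < deg G w -> G c w.
Proof.
case=> T [[[_ acT] subT] stretch] cardX.
have near x y : G x y -> T x y \/ exists2 z, T x z & T z y.
  move=> Gxy; apply: dist_le2; last exact: stretch.
    exact: leq_trans cardX (max_card _).
  exact: adj_neq Gxy.
have /card_gt1P[a [b [aX bX ab]]] : 1 < #|X| by exact: ltnW.
have [|c cP] := center_of_diameter_le2 acT aX bX ab.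
  by move=> x y xX yX xy; apply/near/split_clique.
(* A center outside [X] would be adjacent to all of [X] in [G] too. *)
have cX : c \in X.
  apply/idPn => cX; have [x xX /negP] := split_nonadj cX; apply.
  by apply/subT/cP => //; apply: contraNneq cX => <-.
exists c => // w wX /card_gt1P[x1 [x2 [+ + x12]]]; rewrite !inE => Gw1 Gw2.
apply/idPn => nGcw.
(* If [c] misses [w], each edge [wx] of [G] lies in [T]: a detour [w z x] would make [c z x] a
   triangle of [T]. Two such edges then close the 4-cycle [w x1 c x2]. *)
have direct x : G w x -> x != c /\ T w x.
  move=> Gwx; have xc : x != c.
    by apply: contraNneq nGcw => <-; rewrite adj_sym.
  split=> //; case: (near _ _ Gwx) => [//|[z Twz Tzx]]; exfalso.
  have zX := split_adjX wX (subT _ _ Twz).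
  have zc : z != c.
    by apply: contraNneq nGcw => <-; rewrite adj_sym; exact: subT.
  apply: (no_cycle3 acT (cP _ zX zc) Tzx); rewrite adj_sym.
  exact: cP (split_adjX wX Gwx) xc.
have [x1c T1] := direct _ Gw1; have [x2c T2] := direct _ Gw2.
apply: (no_cycle4 acT (a := w) (c := c) _ x12 T1).
- by apply: contraNneq wX => ->.
- by rewrite adj_sym; apply: cP (split_adjX wX Gw1) x1c.
- exact: cP (split_adjX wX Gw2) x2c.
- by rewrite adj_sym.
Qed.

End SplitGraph.

Theorem theorem6 (V : finType) (G : sgraph V) (X Y : {set V}) :
  connected G ->
  split_partition G X Y ->
  stretch_index_is G 2 ->
  ~~ odd (max_deg G) ->
  neighborhood_overfull G <->
  (exists v : V,
     [/\ v \in X,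
         universal_in G (~: pendants G) v,
         max_deg (induced G (closed_neigh G v)) = max_deg G
       & overfull (induced G (closed_neigh G v))]).
Proof.
move=> conG splitG [spanG _] evD; split; last first.
  by case=> v [_ _ /max_deg_induced_closed_neigh degv ovf]; exists v.
case=> v [degv ovf]; exists v.
have vX := max_deg_in_clique splitG conG degv.
have maxv : max_deg (induced G (closed_neigh G v)) = max_deg G.
  exact/max_deg_induced_closed_neigh.
split=> //.
have no_pendant p : G v p -> deg G p != 1.
  move=> Gvp; apply/eqP => degp.
  have pS : p \in closed_neigh G v by rewrite !inE Gvp orbT.
  move: ovf; apply/negP; apply: (@not_overfull_deg_le1 _ _ (Sub p pS)).
  - by rewrite maxv.
  - by rewrite maxv card_sig card_closed_neigh degv.
  - by rewrite -degp deg_induced_le.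
have vP : v \in ~: pendants G.
  by rewrite !inE degv; apply: contraNneq evD => ->.
apply/existsP; exists (Sub v vP); rewrite eqxx /=.
apply/forallP => -[w wP]; apply/implyP => nwv; rewrite /= /induced_adj /=.
have {nwv} wv : w != v by [].
apply/idPn => nGvw.
have wX : w \notin X.
  by apply: contra nGvw => wX; rewrite (split_clique splitG) // eq_sym.
have degw : 1 < deg G w.
  by move: wP (connected_deg_gt0 conG wv); rewrite !inE; case: (deg G w) => [|[]].
(* Besides [v], the clique contains two neighbors of [w], and [v] is not adjacent to [w]. *)
have cardX : 2 < #|X|.
  move/card_gt1P: (degw) => [x1 [x2 [+ + x12]]]; rewrite !inE => Gw1 Gw2.
  apply/card_gt2P; exists v, x1, x2; split; split=> //.
  - exact: split_adjX splitG _ _ wX Gw1.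
  - exact: split_adjX splitG _ _ wX Gw2.
  - by apply: contraNneq nGvw => ->; rewrite adj_sym.
  - by apply: contraNneq nGvw => <-; rewrite adj_sym.
have [c cX cP] := split_spanner_center splitG spanG cardX.
have Gcw := cP w wX degw.
case: (boolP (closed_neigh G v \subset closed_neigh G c)) => [sub|].
  have : closed_neigh G v \proper closed_neigh G c.
    apply/properP; split=> //; exists w; first by rewrite !inE Gcw orbT.
    by rewrite !inE negb_or wv.
  move/proper_card; rewrite !card_closed_neigh degv ltnS ltnNge.
  by rewrite deg_le_max.
case/subsetPn=> p pv; rewrite !inE negb_or => /andP[pc nGcp].
have pX : p \notin X.
  by apply: contra nGcp => pX; rewrite (split_clique splitG) // eq_sym.
have pv' : p != v by apply: contraNneq pX => ->.
have Gvp : G v p by move: pv; rewrite !inE (negbTE pv').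
case/negP: nGcp; apply: cP => //.
have := no_pendant p Gvp; have := connected_deg_gt0 conG pv'.
by case: (deg G p) => [|[]].
Qed.
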